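(* Suppose $n_{\mathcal Z}+n_{\mathcal U}\ge 3$ and $N=0$ (no initial data). Let $C:\mathcal Z\times\mathcal U\to\mathbb R$ have a Lipschitz continuous gradient with known constant $L_C>0$ and satisfy $\|\nabla C(s)\|\le G$ for all $s\in\mathcal Z\times\mathcal U$, for some known $G>0$. Then the data-driven control algorithm described in the context, run with parameters $\alpha=0$ and $\beta>0$, incurs average regret $$R_T\le \widehat M\,T^{-\frac{2}{n_{\mathcal Z}+n_{\mathcal U}}},$$ where $\widehat M$ is a positive constant that depends on $L_C$, $G$, $\alpha$, $\beta$, and the diameters and dimensions of the sets $\mathcal Z$ and $\mathcal U$.
   Context: Setting. $\mathcal X\subset\mathbb R^{n_{\mathcal X}}$ and $\mathcal U\subset\mathbb R^{n_{\mathcal U}}$ are known, convex and compact. The dynamics are $x_{t+1}=F(x_t,u_t)$ with an unknown map $F:\mathcal X\times\mathcal U\to\mathcal X$. A known context map $\Phi:\mathbb R^{n_{\mathcal X}}\to\mathbb R^{n_{\mathcal Z}}$ ($n_{\mathcal Z}\ge n_{\mathcal X}$) is given, $\mathcal Z=\Phi(\mathcal X)$ is assumed compact, and $z_t=\Phi(x_t)$. The one-step cost is an unknown function $C:\mathcal Z\times\mathcal U\to\mathbb R$. ''$C$ has a Lipschitz continuous gradient with constant $L_C$'' means: $C$ is continuously differentiable on $\mathcal Z\times\mathcal U$ and $\|\nabla C(y)-\nabla C(x)\|\le L_C\|y-x\|$ for all $x,y\in\mathcal Z\times\mathcal U$. $\|\cdot\|$ is the Euclidean norm. $T$ is the (positive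 integer) number of control time steps. Data-driven bounds. For $t\ge1$, given past context-control pairs $q_i=(z_i,u_i)$, $i=0,\dots,t-1$, and $\ell(s;C,q)=C(q)+\nabla C(q)\cdot(s-q)$, put $$C_{t-1}^+(s)=\min_{0\le i\le t-1}\Big(\ell(s;C,q_i)+\tfrac{L_C}{2}\|s-q_i\|^2\Big),\qquad C_{t-1}^-(s)=\max_{0\le i\le t-1}\Big(\ell(s;C,q_i)-\tfrac{L_C}{2}\|s-q_i\|^2\Big),$$ and $m_{t,\alpha,\beta}(z,u)=\alpha C_{t-1}^+(z,u)+\beta C_{t-1}^-(z,u)$. Algorithm (with $N=0$). Start from $x_0\in\mathcal X$; since no data is available at time $0$, $u_0\in\mathcal U$ is arbitrary. At each time $t\ge1$, having observed $x_t$ (hence $z_t$), and $C(q_i),\nabla C(q_i)$ for $i<t$, apply a minimizer $u_t$ of $m_{t,\alpha,\beta}(z_t,\cdot)$ over $\mathcal U$; then $x_{t+1}=F(x_t,u_t)$. Regret. $\rho_t=C(z_t,u_t)-\min_{u\in\mathcal U}C(z_t,u)$. Average regret (for $N=0$): $R_T=\frac1T\sum_{t=0}^{T}\rho_t$.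
   Formalization: The gradient of C is assumed Lipschitz with constant L_C on some convex set containing Z×U (Z×U itself if Z is convex); with Z only compact, e.g. two points, the lower bound C^- can exceed C and the claimed regret bound fails. *)

(* Defs.v *)
From HB Require Import structures.
From mathcomp Require Import all_boot all_order all_algebra.
From mathcomp Require Import all_classical all_reals all_analysis.
Import Order.TTheory GRing.Theory Num.Theory.
Import numFieldNormedType.Exports.

Set Implicit Arguments.
Unset Strict Implicit.
Unset Printing Implicit Defensive.

Local Open Scope classical_set_scope.
Local Open Scope ring_scope.

(* The library norm on ['rV[R]_n] is the sup norm; it induces the same topology
   as [enorm], but the constants below refer to the Euclidean norm. *)
Definition dotv (R : realType) (n : nat) (u v : 'rV[R]_n) : R :=
  \sum_(i < n) u 0 i * v 0 i.

Definition enorm (R : realType) (n : nat) (v : 'rV[R]_n) : R :=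
  Num.sqrt (dotv v v).

Definition diam (R : realType) (n : nat) (A : set 'rV[R]_n) : R :=
  sup [set enorm (a - b) | a in A & b in A].

Definition is_convex (R : realType) (n : nat) (A : set 'rV[R]_n) : Prop :=
  convex_set (A : set (convex_lmodType 'rV[R]_n)).

(* R^m x R^n is identified with R^(m+n). *)
Definition prodset (R : realType) (m n : nat)
    (A : set 'rV[R]_m) (B : set 'rV[R]_n) : set 'rV[R]_(m + n) :=
  [set row_mx a b | a in A & b in B].

(* [g] is a gradient of [f] on [D], relative to [D]: only the values of [f] on
   [D] matter, and [D] need not be open.  (When [D] has empty interior, [g] is
   not determined by [f]; it is the gradient that is supplied as data.) *)
Definition gradient_on (R : realType) (n : nat) (D : set 'rV[R]_n)
    (f : 'rV[R]_n -> R) (g : 'rV[R]_n -> 'rV[R]_n) : Prop :=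
  forall p, D p ->
    (fun s => (f s - f p - dotv (g p) (s - p)) / enorm (s - p))
      @ within D (dnbhs p) --> (0 : R).

(* To be used on a convex [D]: the quadratic bounds [upper_bound] and
   [lower_bound] are valid only for points joined by a segment inside [D]. *)
Definition lipschitz_gradient (R : realType) (n : nat) (D : set 'rV[R]_n)
    (f : 'rV[R]_n -> R) (g : 'rV[R]_n -> 'rV[R]_n) (L : R) : Prop :=
  [/\ gradient_on D f g,
      {within D, continuous g} &
      forall x y, D x -> D y -> enorm (g y - g x) <= L * enorm (y - x)].

Definition linearization (R : realType) (n : nat) (f : 'rV[R]_n -> R)
    (g : 'rV[R]_n -> 'rV[R]_n) (s q : 'rV[R]_n) : R :=
  f q + dotv (g q) (s - q).

(* [upper_bound f g L q t] and [lower_bound f g L q t] use the data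
   q_0, ..., q_(t-1).  They are meant for t >= 1: the term of index 0, which
   seeds the iterated min/max, is then one of the terms. *)
Definition upper_bound (R : realType) (n : nat) (f : 'rV[R]_n -> R)
    (g : 'rV[R]_n -> 'rV[R]_n) (L : R) (q : nat -> 'rV[R]_n) (t : nat)
    (s : 'rV[R]_n) : R :=
  let b i := linearization f g s (q i) + L / 2 * enorm (s - q i) ^+ 2 in
  \big[Num.min/b 0%N]_(i < t) b i.

Definition lower_bound (R : realType) (n : nat) (f : 'rV[R]_n -> R)
    (g : 'rV[R]_n -> 'rV[R]_n) (L : R) (q : nat -> 'rV[R]_n) (t : nat)
    (s : 'rV[R]_n) : R :=
  let b i := linearization f g s (q i) - L / 2 * enorm (s - q i) ^+ 2 in
  \big[Num.max/b 0%N]_(i < t) b i.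

Definition surrogate (R : realType) (n : nat) (f : 'rV[R]_n -> R)
    (g : 'rV[R]_n -> 'rV[R]_n) (L alpha beta : R) (q : nat -> 'rV[R]_n)
    (t : nat) (s : 'rV[R]_n) : R :=
  alpha * upper_bound f g L q t s + beta * lower_bound f g L q t s.

Definition is_minimizer (R : realType) (T : Type) (A : set T) (h : T -> R)
    (a : T) : Prop :=
  A a /\ forall b, A b -> h a <= h b.

(* q_t = (z_t, u_t), with z_t = Phi x_t. *)
Definition ctx_ctrl (R : realType) (nX nZ nU : nat)
    (Phi : 'rV[R]_nX -> 'rV[R]_nZ)
    (x : nat -> 'rV[R]_nX) (u : nat -> 'rV[R]_nU) (t : nat) : 'rV[R]_(nZ + nU) :=
  row_mx (Phi (x t)) (u t).

(* [x], [u] is a run up to time [T] of the algorithm without initial data;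
   values of [x] and [u] at times greater than [T] are irrelevant. *)
Definition algorithm_run (R : realType) (nX nZ nU : nat)
    (X : set 'rV[R]_nX) (U : set 'rV[R]_nU)
    (F : 'rV[R]_nX -> 'rV[R]_nU -> 'rV[R]_nX) (Phi : 'rV[R]_nX -> 'rV[R]_nZ)
    (C : 'rV[R]_(nZ + nU) -> R) (gradC : 'rV[R]_(nZ + nU) -> 'rV[R]_(nZ + nU))
    (L alpha beta : R) (T : nat)
    (x : nat -> 'rV[R]_nX) (u : nat -> 'rV[R]_nU) : Prop :=
  [/\ X (x 0%N),
      U (u 0%N),
      forall t, (t < T)%N -> x t.+1 = F (x t) (u t) &
      forall t, (1 <= t <= T)%N ->
        is_minimizer U
          (fun v => surrogate C gradC L alpha beta (ctx_ctrl Phi x u) t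
                      (row_mx (Phi (x t)) v))
          (u t)].

(* The infimum is a minimum when [U] is compact and nonempty and C(z_t, .) is
   continuous on [U]. *)
Definition regret (R : realType) (nX nZ nU : nat) (U : set 'rV[R]_nU)
    (Phi : 'rV[R]_nX -> 'rV[R]_nZ) (C : 'rV[R]_(nZ + nU) -> R)
    (x : nat -> 'rV[R]_nX) (u : nat -> 'rV[R]_nU) (t : nat) : R :=
  C (ctx_ctrl Phi x u t) - inf [set C (row_mx (Phi (x t)) v) | v in U].

(* T+1 terms, normalized by T. *)
Definition average_regret (R : realType) (nX nZ nU : nat) (U : set 'rV[R]_nU)
    (Phi : 'rV[R]_nX -> 'rV[R]_nZ) (C : 'rV[R]_(nZ + nU) -> R)
    (x : nat -> 'rV[R]_nX) (u : nat -> 'rV[R]_nU) (T : nat) : R :=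
  T%:R^-1 * \sum_(0 <= t < T.+1) regret U Phi C x u t.

(* Main.v *)
(* With alpha = 0 the control u_t minimizes the lower bound C^- <= C, so the
   regret at time t is at most C(q_t) - C^-(q_t), hence at most L |q_t - q_i|^2
   for every i < t.  The sum over t of the squared distance from q_t to the past
   is estimated dyadically: if q_t lies in a cell of side ~ 2^-j visited before,
   that squared distance is O(4^-j), and at most 2^(jd) times t are the first
   visit to a cell of level j, where d = nZ + nU.  For d >= 3 the sum over j of
   4^-j 2^(jd) is geometric and dominated by its last term; stopping at the
   level J with 2^(Jd) ~ T gives O(T^(1 - 2/d)). *)
Require Import Defs.
From HB Require Import structures.
From mathcomp Require Import all_boot all_order all_algebra.
From mathcomp Require Import all_classical all_reals all_analysis.
From mathcomp Require Import ring lra.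

Set Implicit Arguments.
Unset Strict Implicit.
Unset Printing Implicit Defensive.

Import Order.TTheory GRing.Theory Num.Theory.
Import numFieldNormedType.Exports.
Local Open Scope classical_set_scope.
Local Open Scope ring_scope.

(** * Euclidean inner product and norm *)

Lemma dotvDr (R : realType) (n : nat) (u v w : 'rV[R]_n) :
  dotv u (v + w) = dotv u v + dotv u w.
Proof.
by rewrite /dotv -big_split; apply: eq_bigr => i _; rewrite mxE mulrDr.
Qed.

Lemma dotvZr (R : realType) (n : nat) (a : R) (u v : 'rV[R]_n) :
  dotv u (a *: v) = a * dotv u v.
Proof. by rewrite /dotv mulr_sumr; apply: eq_bigr => i _; rewrite mxE; ring. Qed.

Lemma dotvC (R : realType) (n : nat) (u v : 'rV[R]_n) : dotv u v = dotv v u.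
Proof. by apply: eq_bigr => i _; rewrite mulrC. Qed.

Lemma dotvBr (R : realType) (n : nat) (u v w : 'rV[R]_n) :
  dotv u (v - w) = dotv u v - dotv u w.
Proof. by rewrite -scaleN1r dotvDr dotvZr mulN1r. Qed.

Lemma dotvBl (R : realType) (n : nat) (u v w : 'rV[R]_n) :
  dotv (u - v) w = dotv u w - dotv v w.
Proof. by rewrite dotvC dotvBr !(dotvC w). Qed.

Lemma dotvv_ge0 (R : realType) (n : nat) (v : 'rV[R]_n) : 0 <= dotv v v.
Proof. by apply: sumr_ge0 => i _; rewrite -expr2 sqr_ge0. Qed.

Lemma enorm_ge0 (R : realType) (n : nat) (v : 'rV[R]_n) : 0 <= enorm v.
Proof. exact: sqrtr_ge0. Qed.

Lemma enorm_sqr (R : realType) (n : nat) (v : 'rV[R]_n) : enorm v ^+ 2 = dotv v v.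
Proof. by rewrite sqr_sqrtr // dotvv_ge0. Qed.

Lemma enormZ (R : realType) (n : nat) (a : R) (v : 'rV[R]_n) :
  enorm (a *: v) = `|a| * enorm v.
Proof.
by rewrite /enorm dotvZr dotvC dotvZr mulrA sqrtrM ?sqr_ge0 // -expr2 sqrtr_sqr.
Qed.

Lemma enorm_entry (R : realType) (n : nat) (v : 'rV[R]_n) (i : 'I_n) :
  `|v 0 i| <= enorm v.
Proof.
rewrite -(@ler_pXn2r _ 2) ?nnegrE ?normr_ge0 ?enorm_ge0 // enorm_sqr real_normK ?num_real //.
rewrite /dotv (bigD1 i) //= expr2 lerDl; apply: sumr_ge0 => j _.
by rewrite -expr2 sqr_ge0.
Qed.

Lemma subv_entry (R : realType) (n : nat) (u v : 'rV[R]_n) (i : 'I_n) :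
  (u - v) 0 i = u 0 i - v 0 i.
Proof. by rewrite !mxE. Qed.

Lemma enorm0_eq0 (R : realType) (n : nat) (v : 'rV[R]_n) : enorm v = 0 -> v = 0.
Proof.
move=> v0; apply/rowP => i; rewrite mxE; apply/eqP.
by rewrite -normr_le0 -v0 enorm_entry.
Qed.

(** Cauchy-Schwarz: the squared norm of [enorm v *: u - enorm u *: v] is nonnegative and factors as
    2 |u| |v| (|u| |v| - u.v). Zero norms are treated apart, since 2 |u| |v| is then cancelled. *)
Lemma dotv_le_enorm (R : realType) (n : nat) (u v : 'rV[R]_n) :
  dotv u v <= enorm u * enorm v.
Proof.
have dot0 (w : 'rV[R]_n) : dotv w 0 = 0 by rewrite -(scale0r 0) dotvZr mul0r.
have [/enorm0_eq0->|u0] := eqVneq (enorm u) 0.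
  by rewrite dotvC dot0 mulr_ge0 ?enorm_ge0.
have [/enorm0_eq0->|v0] := eqVneq (enorm v) 0.
  by rewrite dot0 mulr_ge0 ?enorm_ge0.
have := dotvv_ge0 (enorm v *: u - enorm u *: v).
have -> : dotv (enorm v *: u - enorm u *: v) (enorm v *: u - enorm u *: v) =
    2 * (enorm u * enorm v) * (enorm u * enorm v - dotv u v).
  rewrite dotvBr !dotvBl !dotvZr ![dotv (_ *: _) _]dotvC !dotvZr -!enorm_sqr.
  by rewrite (dotvC v u); ring.
by rewrite pmulr_rge0 ?subr_ge0 // !mulr_gt0 // lt_neqAle eq_sym enorm_ge0 ?u0 ?v0.
Qed.

Lemma enorm_le_entries (R : realType) (n : nat) (c : R) (v : 'rV[R]_n) :
  (forall i, `|v 0 i| <= c) -> enorm v ^+ 2 <= n%:R * c ^+ 2.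
Proof.
move=> vc; rewrite enorm_sqr /dotv.
rewrite [leRHS](_ : _ = \sum_(i < n) c ^+ 2); last first.
  by rewrite sumr_const card_ord mulr_natl.
apply: ler_sum => i _; rewrite -expr2 -(real_normK (num_real _)).
by rewrite lerXn2r ?nnegrE //; apply: le_trans (vc i).
Qed.

Lemma enormN (R : realType) (n : nat) (v : 'rV[R]_n) : enorm (- v) = enorm v.
Proof. by rewrite -scaleN1r enormZ normrN1 mul1r. Qed.

(** * Quadratic bounds from a Lipschitz gradient *)

Lemma gradient_on_local (R : realType) (n : nat) (D : set 'rV[R]_n)
    (f : 'rV[R]_n -> R) (g : 'rV[R]_n -> 'rV[R]_n) (p : 'rV[R]_n) (e : R) :
  gradient_on D f g -> D p -> 0 < e ->
  exists2 r, 0 < r & forall s, D s -> enorm (s - p) < r ->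
    `|f s - f p - dotv (g p) (s - p)| <= e * enorm (s - p).
Proof.
move=> fg Dp e0; have /cvgrPdist_le/(_ e e0) := fg p Dp.
rewrite /prop_near1 /within /= => /nbhs_ballP[r /= r0 pr].
exists r => // s Ds spr.
have [->|sp] := eqVneq s p.
  have dot0 : dotv (g p) 0 = 0 by rewrite -(scale0r 0) dotvZr mul0r.
  by rewrite !subrr dot0 subr0 normr0 mulr_ge0 ?enorm_ge0 // ltW.
have sp0 : 0 < enorm (s - p).
  rewrite lt_neqAle enorm_ge0 andbT eq_sym; apply: contra sp => /eqP/enorm0_eq0/eqP.
  by rewrite subr_eq0.
(* Library balls are those of the sup norm, which the Euclidean norm dominates, so the same radius
   serves. *)
have /pr/(_ sp Ds) : ball p r s.
  split=> // i j; rewrite /ball /= (ord1 i).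
  have := enorm_entry (p - s) j; rewrite !mxE => /le_lt_trans; apply.
  by rewrite -opprB enormN.
by rewrite sub0r normrN normrM normfV (ger0_norm (enorm_ge0 _)) ler_pdivrMr.
Qed.

(* Only values on [0, 1] enter the hypothesis: outside of this interval [phi]
   is the restriction of [f] to a line which has left [D]. *)
Lemma taylor_unit_segment (R : realType) (phi dphi : R -> R) (K : R) :
  (forall t : R, 0 <= t <= 1 -> forall e : R, 0 < e -> exists2 r : R, 0 < r &
     forall s : R, 0 <= s <= 1 -> `|s - t| < r ->
       `|phi s - phi t - dphi t * (s - t)| <= e * `|s - t|) ->
  (forall t : R, 0 <= t <= 1 -> dphi t - dphi 0 <= K * t) ->
  phi 1 - phi 0 - dphi 0 <= K / 2.
Proof.
move=> hphi hK.
have dphiP (t : R) : t \in `]0, 1[ -> is_derive t 1 phi (dphi t).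
  rewrite in_itv /= => /andP[t0 t1].
  suff H : (fun h => h^-1 *: ((phi \o shift t) (h *: 1) - phi t)) @ 0^' --> dphi t.
    by apply: DeriveDef; [exact: cvgP H | exact: cvg_lim H].
  apply/cvgrPdist_le => e e0.
  have [|r r0 hr] := hphi t _ e e0; first by rewrite !ltW.
  (* Below this radius [t + h] stays in [0, 1], where [hphi] applies. *)
  have : 0 < Num.min r (Num.min t (1 - t)) by rewrite !lt_min r0 t0 subr_gt0.
  move=> m0; near=> h.
  have h0 : h != 0 by near: h; exact: nbhs_dnbhs_neq.
  have : `|h| < Num.min r (Num.min t (1 - t)).
    by near: h; apply: dnbhs0_lt.
  rewrite !lt_min => /and3P[hr' ht h1t].
  have := hr (t + h); rewrite addrAC subrr add0r => /(_ _ hr').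
  rewrite /= /GRing.scale /= mulr1 (addrC h t) => hh.
  rewrite [X in `|X|](_ : _ = - (phi (t + h) - phi t - dphi t * h) / h); last by field.
  rewrite normrM normfV normrN ler_pdivrMr ?normr_gt0 //; apply: hh.
  by move: ht h1t; rewrite !ltr_norml; lra.
have cphi : {within `[0, 1], continuous phi}.
  apply/subspace_continuousP => t; rewrite /= in_itv /= => t01.
  apply/cvgrPdist_le => e e0.
  (* Error factor 1 gives |phi s - phi t| <= (1 + |dphi t|) |s - t| near [t], at the end points
     too. *)
  have [r r0 hr] := hphi t t01 1 ltr01.
  have c0 : 0 < 1 + `|dphi t| by rewrite ltr_pwDl.
  rewrite /prop_near1 /within /=; apply/nbhs_ballP.
  exists (Num.min r (e / (1 + `|dphi t|))); first by rewrite /= lt_min r0 divr_gt0.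
  move=> s; rewrite /ball /= lt_min distrC in_itv /= => /andP[sr se] s01.
  have tri (a b c : R) : `|a - b - c| + `|c| <= `|s - t| + `|s - t| * `|dphi t| ->
      `|b - a| <= `|s - t| + `|s - t| * `|dphi t|.
    apply: le_trans; rewrite -normrN (le_trans _ (ler_normD _ _)) //.
    by rewrite opprB subrK.
  move: se; rewrite ltr_pdivlMr // mulrDr mulr1 => /ltW; apply: le_trans.
  apply: (tri _ _ (dphi t * (s - t))); rewrite normrM [_ * `|s - t|]mulrC lerD2r.
  by have := hr s s01 sr; rewrite mul1r.
(* By [hK] the derivative of [psi] is at most 0 on ]0, 1[, so the mean value theorem gives psi 1 <=
   psi 0, which is the claim. *)
pose psi t : R := phi t - dphi 0 * t - K / 2 * t ^+ 2.
have psiP (t : R) : t \in `]0, 1[ -> is_derive t 1 psi (dphi t - dphi 0 - K * t).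
  move=> t01; have := dphiP t t01 => ?.
  apply: is_derive_eq.
  by rewrite /GRing.scale /=; field.
have cpsi : {within `[0, 1], continuous psi}.
  have clin : {within `[0, 1], continuous (fun t : R => dphi 0 * t)}.
    by apply: continuous_subspaceT => t; apply: cvgM; [exact: cvg_cst|exact: cvg_id].
  have csqr : {within `[0, 1], continuous (fun t : R => K / 2 * t ^+ 2)}.
    apply: continuous_subspaceT => t; apply: cvgM; first exact: cvg_cst.
    exact: exprn_continuous.
  move=> t; apply: cvgB; last exact: csqr.
  by apply: cvgB; [exact: cphi | exact: clin].
have [t] := MVT ltr01 psiP cpsi.
rewrite in_itv /= => /andP[t0 t1]; rewrite subr0 mulr1 => psiE.
have t01 : 0 <= t <= 1 by rewrite !ltW.
have := hK t t01; move: psiE; rewrite /psi; lra.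
Unshelve. all: by end_near. Qed.

Lemma is_convex_segment (R : realType) (n : nat) (D : set 'rV[R]_n)
    (p s : 'rV[R]_n) (t : R) :
  is_convex D -> D p -> D s -> 0 <= t <= 1 -> D (p + t *: (s - p)).
Proof.
move=> convD Dp Ds t01.
have := convD s p (Itv01 (proj1 (andP t01)) (proj2 (andP t01))).
rewrite !inE => /(_ Ds Dp); rewrite /conv /=; congr D.
by rewrite /= scalerBr scalerBl scale1r addrCA; congr (_ + _); rewrite addrC.
Qed.

(** Along the segment from [p] to [s], with v = s - p, the slope of [f] grows by at most L t |v|^2
    up to parameter t, by Cauchy-Schwarz and the Lipschitz bound; [taylor_unit_segment] then
    integrates this. *)
Lemma quadratic_upper (R : realType) (n : nat) (D : set 'rV[R]_n)
    (f : 'rV[R]_n -> R) (g : 'rV[R]_n -> 'rV[R]_n) (L : R) (p s : 'rV[R]_n) :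
  is_convex D -> gradient_on D f g ->
  (forall x y, D x -> D y -> enorm (g y - g x) <= L * enorm (y - x)) ->
  D p -> D s ->
  f s - f p - dotv (g p) (s - p) <= L / 2 * enorm (s - p) ^+ 2.
Proof.
move=> convD fg gL Dp Ds; set v := s - p.
have Dpt t : 0 <= t <= 1 -> D (p + t *: v) by exact: is_convex_segment.
have diffE t t' : p + t' *: v - (p + t *: v) = (t' - t) *: v.
  by rewrite opprD addrACA subrr add0r -scalerBl.
have := @taylor_unit_segment R (fun t => f (p + t *: v))
  (fun t => dotv (g (p + t *: v)) v) (L * enorm v ^+ 2).
rewrite !scale0r !addr0 scale1r /v [p + _]addrC subrK -/v mulrAC.
apply => [t t01 e e0|t t01]; last first.
  rewrite -dotvBl; apply: le_trans (dotv_le_enorm _ _) _.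
  have := gL _ _ Dp (Dpt t t01); rewrite addrAC subrr add0r enormZ.
  move: t01 => /andP[t0 _]; rewrite (ger0_norm t0) => /(ler_wpM2r (enorm_ge0 v)).
  by move=> /le_trans; apply; rewrite le_eqVlt; apply/orP; left; apply/eqP; ring.
(* The added 1 keeps the divisor positive when s = p. *)
have v0 : 0 < enorm v + 1 by rewrite ltr_wpDl ?enorm_ge0.
have [r r0 hr] := gradient_on_local fg (Dpt t t01) (divr_gt0 e0 v0).
exists (r / (enorm v + 1)); first exact: divr_gt0.
move=> t' t'01 tt'; have := hr _ (Dpt t' t'01).
rewrite diffE enormZ dotvZr (mulrC (t' - t)).
have vle : `|t' - t| * enorm v <= `|t' - t| * (enorm v + 1).
  by rewrite ler_wpM2l // lerDl.
rewrite (le_lt_trans vle) -?ltr_pdivlMr // => /(_ isT)/le_trans; apply.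
by rewrite mulrAC ler_pdivrMr // -mulrA ler_wpM2l // ltW.
Qed.

(** This is [quadratic_upper] for -f and -g. *)
Lemma quadratic_lower (R : realType) (n : nat) (D : set 'rV[R]_n)
    (f : 'rV[R]_n -> R) (g : 'rV[R]_n -> 'rV[R]_n) (L : R) (p s : 'rV[R]_n) :
  is_convex D -> gradient_on D f g ->
  (forall x y, D x -> D y -> enorm (g y - g x) <= L * enorm (y - x)) ->
  D p -> D s ->
  linearization f g s p - L / 2 * enorm (s - p) ^+ 2 <= f s.
Proof.
move=> convD fg gL Dp Ds.
have dotN (u v : 'rV[R]_n) : dotv (- u) v = - dotv u v.
  by rewrite dotvC -scaleN1r dotvZr mulN1r dotvC.
have := @quadratic_upper R n D (\- f) (\- g) L p s convD _ _ Dp Ds.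
rewrite /linearization /= dotN => H.
suff: - f s - - f p - - dotv (g p) (s - p) <= L / 2 * enorm (s - p) ^+ 2 by lra.
apply: H => [q Dq|x y Dx Dy]; last by rewrite -opprD enormN; exact: gL.
rewrite (_ : (fun _ => _) = \- (fun s => (f s - f q - dotv (g q) (s - q)) / enorm (s - q))).
  by rewrite -oppr0; apply: cvgN; exact: fg.
by apply/funext => z /=; rewrite dotN -mulNr; congr (_ / _); ring.
Qed.

(** * Diameters and product sets *)

Lemma compact_diam (R : realType) (n : nat) (A : set 'rV[R]_n) (a b : 'rV[R]_n) :
  compact A -> A a -> A b -> enorm (a - b) <= diam A.
Proof.
move=> /compact_bounded[M [_ AM]] Aa Ab; apply: ub_le_sup; last first.
  by exists a => //; exists b.
have entry (v : 'rV[R]_n) i : A v -> `|v 0 i| <= M + 1.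
  have M1 : M < M + 1 by rewrite ltrDl.
  move=> Av; apply: le_trans (AM _ M1 v Av).
  rewrite /Num.norm /= mx_normrE.
  exact: (le_bigmax _ (fun ij : 'I_1 * 'I_n => `|v ij.1 ij.2|) (0, i)).
(* A crude bound, whose only purpose is to make the supremum in [diam] a true upper bound. *)
exists (Num.sqrt (n%:R * (2 * (M + 1)) ^+ 2)) => _ [c Ac [d Ad <-]].
rewrite ler_sqrt -?enorm_sqr; last by rewrite mulr_ge0 // sqr_ge0.
apply: enorm_le_entries => i; rewrite !mxE.
apply: le_trans (ler_normB _ _) _.
by rewrite mulr_natl mulr2n lerD // entry.
Qed.

Lemma enorm_row_mx (R : realType) (m n : nat) (a : 'rV[R]_m) (b : 'rV[R]_n) :
  enorm (row_mx a b) ^+ 2 = enorm a ^+ 2 + enorm b ^+ 2.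
Proof.
rewrite !enorm_sqr /dotv big_split_ord /=; congr (_ + _);
  by apply: eq_bigr => i _; rewrite ?row_mxEl ?row_mxEr.
Qed.

(** * Dyadic cells and the counting of first visits *)

Definition first_visit (K : eqType) (c : nat -> K) (t : nat) : bool :=
  [forall i : 'I_t, c i != c t].

(** Distinct first-visit times carry distinct values of [c], so they inject into [K]. *)
Lemma sum_first_visit (K : finType) (c : nat -> K) (T : nat) :
  (\sum_(1 <= t < T) first_visit c t <= #|K|)%N.
Proof.
apply: (@leq_trans (\sum_(t < T) first_visit c t)).
  case: T => [|T]; first by rewrite big_geq.
  by rewrite -(big_mkord xpredT (fun t => first_visit c t : nat)) (@big_ltn _ _ _ 0) // leq_addl.
rewrite -big_mkcond /= sum1_card -(card_in_imset (f := fun t : 'I_T => c t)).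
  exact: max_card.
move=> s t; rewrite !unfold_in => /forallP fs /forallP ft cst.
case: (ltngtP s t) => [st|ts|/val_inj//].
  by have := ft (Ordinal st); rewrite /= cst eqxx.
by have := fs (Ordinal ts); rewrite /= cst eqxx.
Qed.

(* Meant for [y] in [0, 1)^d.  The codomain is ['I_(2 ^ j)], in the form of a
   successor that [inord] requires. *)
Definition cell (R : realType) (d j : nat) (y : 'I_d -> R) :
    {ffun 'I_d -> 'I_(2 ^ j).-1.+1} :=
  [ffun k => inord (Num.truncn (2 ^+ j * y k))].

Lemma cell_close (R : realType) (d j : nat) (y y' : 'I_d -> R) (k : 'I_d) :
  (forall k, 0 <= y k < 1) -> (forall k, 0 <= y' k < 1) ->
  cell j y = cell j y' -> `|y k - y' k| <= (2 ^+ j)^-1.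
Proof.
move=> y01 y'01 /ffunP/(_ k)/(congr1 (@nat_of_ord _)); rewrite !ffunE.
have p0 : 0 < 2 ^+ j :> R by rewrite exprn_gt0.
(* On [0, 1) the truncation stays below 2^j, so [inord] never falls back on its default value. *)
have lt2 z : 0 <= z < 1 -> (Num.truncn (2 ^+ j * z : R) < (2 ^ j).-1.+1)%N.
  move=> /andP[z0 z1]; rewrite prednK ?expn_gt0 //.
  by rewrite truncn_lt_nat ?mulr_ge0 ?(ltW p0) // natrX -[ltRHS]mulr1 ltr_pM2l.
rewrite !inordK ?lt2 // => e.
have ge0 z : 0 <= z < 1 -> 0 <= 2 ^+ j * z :> R.
  by move=> /andP[z0 _]; rewrite mulr_ge0 // ltW.
have := truncn_itv (ge0 _ (y01 k)); have := truncn_itv (ge0 _ (y'01 k)).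
rewrite e -(natr1 (Num.truncn _)) => /andP[a b] /andP[a' b'].
rewrite -(ler_pM2l p0) divff ?gt_eqF // -{1}(gtr0_norm p0) -normrM mulrBr ler_norml.
by lra.
Qed.

Lemma card_cell (d j : nat) : #|{ffun 'I_d -> 'I_(2 ^ j).-1.+1}| = (2 ^ (j * d))%N.
Proof. by rewrite card_ffun !card_ord prednK ?expn_gt0 // expnM. Qed.

(** With a = 2^(Jd), b = 4^-J and c = 2^d, the induction step reads 8ab + abc <= 2abc, that is 8 <=
    c: this is where d >= 3 enters, and why the constant is 8. *)
Lemma dyadic_sum (R : realType) (d J : nat) : (3 <= d)%N ->
  \sum_(j < J) 4 ^- j * 2 ^+ (j.+1 * d) <= 8 * (2 ^+ (J * d) * 4 ^- J) :> R.
Proof.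
move=> d3; have pos k : 0 < 4 ^- k :> R by rewrite invr_gt0 exprn_gt0.
elim: J => [|J IH]; first by rewrite big_ord0 !mul0n !expr0 invr1; lra.
rewrite big_ord_recr /=; apply: le_trans (lerD IH (lexx _)) _.
have d8 : 8 <= 2 ^+ d :> R.
  by rewrite (_ : 8 = 2 ^+ 3 :> R); [rewrite ler_eXn2l ?ltr1n | ring].
have q0 : 0 <= 2 ^+ (J * d) :> R by rewrite exprn_ge0.
have -> : 4 ^- J.+1 = 4 ^- J / 4 :> R by rewrite exprS invfM mulrC.
rewrite mulSn exprD mulrA.
have := mulr_ge0 q0 (ltW (pos J)).
move: (2 ^+ (J * d)) (4 ^- J : R) d8 => a b; move: (2 ^+ d) => c c8 ab.
have := ler_wpM2r ab c8; lra.
Qed.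

(** Take the last J with 2^(Jd) <= T. Then T < 2^((J+1)d), and raising to the power 2/d gives
    T^(2/d) <= 4^(J+1); the factor 4 is the price of rounding. *)
Lemma dyadic_scale (R : realType) (d T : nat) : (0 < d)%N -> (0 < T)%N ->
  exists J, (2 ^ (J * d) <= T)%N /\ 4 ^- J <= 4 * T%:R `^ (- (2 / d%:R)) :> R.
Proof.
move=> d0 T0; exists (trunc_log (2 ^ d) T).
have p1 : (1 < 2 ^ d)%N by rewrite -{1}(expn0 2) ltn_exp2l.
have := trunc_log_bounds p1 T0; set J := trunc_log _ _.
rewrite /= -!expnM ![(d * _)%N]mulnC => /andP[-> TJ]; split=> //.
rewrite powRN.
have : T%:R `^ (2 / d%:R) <= 4 ^+ J.+1 :> R.
  rewrite (_ : 4 ^+ J.+1 = ((2 ^ (J.+1 * d))%:R : R) `^ (2 / d%:R)).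
    by rewrite ge0_ler_powR ?nnegrE ?divr_ge0 // ler_nat ltnW.
  rewrite natrX -[X in X `^ _]powR_mulrn // -powRrM.
  have -> : (J.+1 * d)%:R * (2 / d%:R) = 2%:R * J.+1%:R :> R.
    by rewrite natrM; field; rewrite pnatr_eq0 -lt0n.
  by rewrite powRrM powR_mulrn // powR_mulrn ?exprn_ge0 //; congr (_ ^+ _); ring.
have t0 : 0 < T%:R `^ (2 / d%:R) :> R by rewrite powR_gt0 // ltr0n.
have p4 : 0 < 4 ^+ J :> R by rewrite exprn_gt0.
by move=> h; rewrite ler_pdivlMr // mulrC ler_pdivrMr // -exprS.
Qed.

(** Induction on the finest level. If [t] is a first visit at level J+1, the new term 4^-J makes up
    for the decrease from 4^-J to 4^-(J+1); otherwise the revisit hypothesis gives A 4^-(J+1)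
    directly. *)
Lemma le_first_visit_sum (R : realType) (d T : nat) (y : nat -> 'I_d -> R)
    (r : nat -> R) (A : R) (t J : nat) :
  0 <= A ->
  (forall t i j, (i < t <= T)%N -> cell j (y i) = cell j (y t) ->
     r t <= A * 4 ^- j) ->
  (0 < t <= T)%N ->
  r t <= A * (4 ^- J +
    \sum_(j < J) 4 ^- j * (first_visit (fun s => cell j.+1 (y s)) t)%:R).
Proof.
move=> A0 hr /andP[t0 tT]; have pos k : 0 <= 4 ^- k :> R by rewrite invr_ge0 exprn_ge0.
elim: J => [|J IH].
  (* Level 0 has a single cell, already visited at time 0. *)
  rewrite big_ord0 addr0; apply: (hr t 0%N 0%N); first by rewrite t0.
  by apply/ffunP => k; rewrite !ffunE; apply: val_inj; rewrite /= !ord1.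
rewrite big_ord_recr /=; have [fv|] := boolP (first_visit _ t).
  rewrite mulr1; apply: le_trans IH _; rewrite ler_wpM2l //.
  by have := pos J.+1; lra.
rewrite negb_forall => /existsP[i]; rewrite negbK => /eqP ci.
rewrite mulr0 addr0; apply: (le_trans (hr t i J.+1 _ ci)).
  by rewrite ltn_ord.
by rewrite ler_wpM2l // lerDl sumr_ge0 // => j _; rewrite mulr_ge0.
Qed.

(** Let P = T^(-2/d). The terms 4^-J sum to T 4^-J <= 4 T P. By [sum_first_visit] and [dyadic_sum],
    the first visits cost at most 8 * 2^(Jd) 4^-J <= 8 T 4^-J <= 32 T P. Hence 36 = 4 + 32. *)
Lemma sum_revisit (R : realType) (d T : nat) (y : nat -> 'I_d -> R)
    (r : nat -> R) (A : R) :
  (3 <= d)%N -> (0 < T)%N -> 0 <= A ->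
  (forall t i j, (i < t <= T)%N -> cell j (y i) = cell j (y t) ->
     r t <= A * 4 ^- j) ->
  \sum_(1 <= t < T.+1) r t <= 36 * A * (T%:R * T%:R `^ (- (2 / d%:R))).
Proof.
move=> d3 T0 A0 hr.
have [J [JT J4]] := dyadic_scale R (ltn_trans (isT : 0 < 2)%N d3) T0.
have pos k : 0 <= 4 ^- k :> R by rewrite invr_ge0 exprn_ge0.
have : \sum_(1 <= t < T.+1) r t <= \sum_(1 <= t < T.+1) A * (4 ^- J +
    \sum_(j < J) 4 ^- j * (first_visit (fun s => cell j.+1 (y s)) t)%:R).
  by apply: ler_sum_nat => t tT; apply: (le_first_visit_sum (T := T)).
move=> /le_trans; apply.
rewrite -mulr_sumr [36 * A]mulrC -mulrA ler_wpM2l // big_split /=.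
rewrite sumr_const_nat subSS subn0 -[_ *+ T]mulr_natl exchange_big /=.
have : \sum_(j < J) \sum_(1 <= t < T.+1)
    4 ^- j * (first_visit (fun s => cell j.+1 (y s)) t)%:R <=
    \sum_(j < J) 4 ^- j * 2 ^+ (j.+1 * d) :> R.
  apply: ler_sum => j _; rewrite -mulr_sumr ler_wpM2l // -natr_sum -natrX ler_nat.
  by rewrite -card_cell sum_first_visit.
have /(le_trans _) := dyadic_sum R J d3 => h /h {}h.
have JT' : 2 ^+ (J * d) <= T%:R :> R by rewrite -natrX ler_nat.
have := ler_wpM2r (pos J) JT'; have := ler_wpM2l (ler0n R T) J4.
by rewrite mulrCA; lra.
Qed.

(** * From the lower bound C^- to the regret *)

Lemma lower_bound_le (R : realType) (n : nat) (D : set 'rV[R]_n)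
    (f : 'rV[R]_n -> R) (g : 'rV[R]_n -> 'rV[R]_n) (L : R)
    (q : nat -> 'rV[R]_n) (t : nat) (s : 'rV[R]_n) :
  is_convex D -> lipschitz_gradient D f g L ->
  (0 < t)%N -> (forall i, (i < t)%N -> D (q i)) -> D s ->
  lower_bound f g L q t s <= f s.
Proof.
move=> convD [fg _ gL] t0 Dq Ds.
(* The seed of the maximum is the term of index 0, a genuine datum since 0 < t. *)
by apply: bigmax_le => [|i _]; apply: (quadratic_lower convD fg gL _ Ds); apply: Dq.
Qed.

(** The upper and lower parabolas at [q i] share their linear part, so they differ by exactly L |s -
    q_i|^2. *)
Lemma lower_bound_gap (R : realType) (n : nat) (D : set 'rV[R]_n)
    (f : 'rV[R]_n -> R) (g : 'rV[R]_n -> 'rV[R]_n) (L : R)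
    (q : nat -> 'rV[R]_n) (t i : nat) (s : 'rV[R]_n) :
  is_convex D -> lipschitz_gradient D f g L ->
  (i < t)%N -> D (q i) -> D s ->
  f s - lower_bound f g L q t s <= L * enorm (s - q i) ^+ 2.
Proof.
move=> convD [fg _ gL] it Dq Ds.
have := quadratic_upper convD fg gL Dq Ds.
have := le_bigmax (linearization f g s (q 0%N) - L / 2 * enorm (s - q 0%N) ^+ 2)
  (fun j : 'I_t => linearization f g s (q j) - L / 2 * enorm (s - q j) ^+ 2)
  (Ordinal it).
rewrite -/(lower_bound f g L q t s) /= {1}/linearization; lra.
Qed.

(** The absolute values let the theorem form its constants from [dZ] and [dU] before these are known
    to be diameters. *)
Lemma prodset_enorm (R : realType) (m n : nat) (A : set 'rV[R]_m)
    (B : set 'rV[R]_n) (p q : 'rV[R]_(m + n)) :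
  compact A -> compact B -> prodset A B p -> prodset A B q ->
  enorm (p - q) <= `|diam A| + `|diam B|.
Proof.
move=> cA cB [a Aa [b Bb <-]] [a' Aa' [b' Bb' <-]].
rewrite opp_row_mx add_row_mx.
rewrite -(@ler_pXn2r _ 2) ?nnegrE ?enorm_ge0 ?addr_ge0 // enorm_row_mx.
have := le_trans (compact_diam cA Aa Aa') (ler_norm _).
have := le_trans (compact_diam cB Bb Bb') (ler_norm _).
have := enorm_ge0 (a - a'); have := enorm_ge0 (b - b'); nra.
Qed.

Lemma run_prodset (R : realType) (nX nZ nU : nat)
    (X : set 'rV[R]_nX) (U : set 'rV[R]_nU)
    (F : 'rV[R]_nX -> 'rV[R]_nU -> 'rV[R]_nX) (Phi : 'rV[R]_nX -> 'rV[R]_nZ)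
    (C : 'rV[R]_(nZ + nU) -> R) (gradC : 'rV[R]_(nZ + nU) -> 'rV[R]_(nZ + nU))
    (L alpha beta : R) (T : nat) (x : nat -> 'rV[R]_nX) (u : nat -> 'rV[R]_nU) :
  (forall y v, X y -> U v -> X (F y v)) ->
  algorithm_run X U F Phi C gradC L alpha beta T x u ->
  forall t, (t <= T)%N ->
    (Phi @` X) (Phi (x t)) /\ prodset (Phi @` X) U (ctx_ctrl Phi x u t).
Proof.
move=> XF [X0 U0 xF umin] t tT.
have Ut s : (s <= T)%N -> U (u s).
  by case: s => [//|s] sT; have [] := umin s.+1 sT.
have Xt : X (x t).
  elim: t tT => [//|t IH] tT; rewrite xF //; apply: XF; first exact/IH/ltnW.
  exact/Ut/ltnW.
have PhiX : (Phi @` X) (Phi (x t)) by exists (x t).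
by split=> //; exists (Phi (x t)) => //; exists (u t) => //; exact: Ut.
Qed.

(** [inf] enters only as a greatest lower bound; [U] must be nonempty because the infimum of the
    empty set is a default value. *)
Lemma regret_le (R : realType) (nX nZ nU : nat) (U : set 'rV[R]_nU)
    (Phi : 'rV[R]_nX -> 'rV[R]_nZ) (C : 'rV[R]_(nZ + nU) -> R)
    (x : nat -> 'rV[R]_nX) (u : nat -> 'rV[R]_nU) (t : nat) (B : R) :
  U !=set0 ->
  (forall v, U v -> C (ctx_ctrl Phi x u t) - C (row_mx (Phi (x t)) v) <= B) ->
  regret U Phi C x u t <= B.
Proof.
move=> [v0 Uv0] h; rewrite /regret lerBlDr -lerBlDl.
apply: lb_le_inf; first by exists (C (row_mx (Phi (x t)) v0)); exists v0.
by move=> _ [v Uv <-]; have := h v Uv; lra.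
Qed.

Theorem theorem2 (R : realType) (nZ nU : nat) (hdim : (3 <= nZ + nU)%N)
    (L G alpha beta dZ dU : R)
    (hL : 0 < L) (hG : 0 < G) (halpha : alpha = 0) (hbeta : 0 < beta) :
  exists M : R, 0 < M /\
    forall (nX : nat) (X : set 'rV[R]_nX) (U : set 'rV[R]_nU)
      (F : 'rV[R]_nX -> 'rV[R]_nU -> 'rV[R]_nX) (Phi : 'rV[R]_nX -> 'rV[R]_nZ)
      (D : set 'rV[R]_(nZ + nU)) (C : 'rV[R]_(nZ + nU) -> R)
      (gradC : 'rV[R]_(nZ + nU) -> 'rV[R]_(nZ + nU))
      (T : nat) (x : nat -> 'rV[R]_nX) (u : nat -> 'rV[R]_nU),
    (nX <= nZ)%N ->
    is_convex X -> compact X ->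
    is_convex U -> compact U ->
    (forall y v, X y -> U v -> X (F y v)) ->
    compact (Phi @` X) ->
    diam (Phi @` X) = dZ -> diam U = dU ->
    is_convex D -> prodset (Phi @` X) U `<=` D ->
    lipschitz_gradient D C gradC L ->
    (forall s, prodset (Phi @` X) U s -> enorm (gradC s) <= G) ->
    (0 < T)%N ->
    algorithm_run X U F Phi C gradC L alpha beta T x u ->
    average_regret U Phi C x u T <= M * T%:R `^ (- (2 / (nZ + nU)%:R)).
Proof.
(* The added 1 makes [W] positive and a strict bound on distances, as half-open cells require. *)
pose W : R := `|dZ| + `|dU| + 1.
have W0 : 0 < W by rewrite ltr_wpDl ?addr_ge0.
(* A cell of level j has side 2W 2^-j in the original coordinates; [A] is [L] times the bound d
   (2W)^2 on the squared diameter at level 0. *)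
pose A : R := L * ((nZ + nU)%:R * (2 * W) ^+ 2).
have A0 : 0 <= A by rewrite !mulr_ge0 ?sqr_ge0 // ltW.
pose B : R := G * W + L / 2 * W ^+ 2.
have B0 : 0 < B by rewrite addr_gt0 ?mulr_gt0 ?exprn_gt0 ?invr_gt0.
exists (B + 36 * A); split; first by rewrite ltr_pwDl // mulr_ge0.
move=> nX X U F Phi D C gradC T x u _ _ _ _ cU XF cZ dZE dUE convD SD lipC gradG T0 run.
have Sq := run_prodset XF run; set q := ctx_ctrl Phi x u in Sq.
have Dq t : (t <= T)%N -> D (q t) by move=> /Sq[_ /SD].
have [_ U0 _ umin] := run.
have Une : U !=set0 by exists (u 0%N).
have Srow t v : (t <= T)%N -> U v -> prodset (Phi @` X) U (row_mx (Phi (x t)) v).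
  by move=> /Sq[Zt _] Uv; exists (Phi (x t)) => //; exists v.
have distW p p' : prodset (Phi @` X) U p -> prodset (Phi @` X) U p' -> enorm (p - p') < W.
  move=> Sp Sp'; have := prodset_enorm cZ cU Sp Sp'.
  by rewrite dZE dUE /W; lra.
(* The control at time 0 is arbitrary, so only the gradient bound [G] and the diameter limit this
   term. *)
have regret0 : regret U Phi C x u 0 <= B.
  apply: regret_le => // v Uv; set s := row_mx _ v; rewrite -/q.
  have [fg _ gL] := lipC.
  have := quadratic_lower convD fg gL (Dq 0%N isT) (SD _ (Srow 0%N v isT Uv)).
  rewrite -/s /linearization.
  have := dotv_le_enorm (gradC (q 0%N)) (q 0%N - s).
  rewrite -opprB -scaleN1r dotvZr mulN1r scaleN1r enormN.
  have sW := distW _ _ (Srow 0%N v isT Uv) (Sq 0%N isT).2.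
  have e0 := enorm_ge0 (s - q 0%N).
  have := ler_pM (enorm_ge0 _) e0 (gradG _ (Sq 0%N isT).2) (ltW sW).
  have : L / 2 * enorm (s - q 0%N) ^+ 2 <= L / 2 * W ^+ 2.
    by rewrite ler_wpM2l ?divr_ge0 ?(ltW hL) // lerXn2r ?nnegrE ?(ltW W0) ?(ltW sW).
  rewrite /B; lra.
(* For v in U: C(q_t) - C(z_t, v) <= C(q_t) - C^-(z_t, v) <= C(q_t) - C^-(q_t) <= L |q_t - q_i|^2,
   the middle step by minimality of u_t. *)
have regret_t t i : (i < t <= T)%N ->
    regret U Phi C x u t <= L * enorm (q t - q i) ^+ 2.
  move=> /andP[it tT]; have t0 : (0 < t)%N := leq_ltn_trans (leq0n i) it.
  apply: regret_le => // v Uv; set s := row_mx _ v; rewrite -/q.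
  have Ds : D s by apply: SD; exact: Srow.
  have := lower_bound_gap convD lipC it (Dq i (ltnW (leq_trans it tT))) (Dq t tT).
  have Dlt j : (j < t)%N -> D (q j) by move=> jt; apply/Dq/ltnW/(leq_trans jt).
  have := lower_bound_le convD lipC t0 Dlt Ds.
  have [_ /(_ v Uv)] := umin t (introT andP (conj t0 tT)).
  rewrite /surrogate halpha !mul0r !add0r ler_pM2l // -/q -/s.
  rewrite -[row_mx _ (u t)]/(q t); lra.
(* Centring at q_0 places every coordinate strictly between -W and W, which is rescaled into [0,
   1). *)
pose y t k : R := (q t 0 k - q 0%N 0 k + W) / (2 * W).
have W2 : 0 < 2 * W by rewrite mulr_gt0.
have y01 t : (t <= T)%N -> forall k, 0 <= y t k < 1.
  move=> tT k; have := enorm_entry (q t - q 0%N) k.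
  move=> /le_lt_trans/(_ (distW _ _ (Sq t tT).2 (Sq 0%N isT).2)).
  rewrite subv_entry ltr_norml => /andP[h1 h2].
  by apply/andP; split; [apply: divr_ge0 | rewrite ltr_pdivrMr //]; lra.
have revisit t i j : (i < t <= T)%N -> cell j (y i) = cell j (y t) ->
    regret U Phi C x u t <= A * 4 ^- j.
  move=> /[dup] itT /andP[it tT] cE; apply: (le_trans (regret_t t i itT)).
  rewrite /A -mulrA ler_pM2l //.
  have -> : (nZ + nU)%:R * (2 * W) ^+ 2 * 4 ^- j =
      (nZ + nU)%:R * (2 * W * (2 ^+ j)^-1) ^+ 2 :> R.
    have -> : 4 ^- j = (2 ^+ j)^-1 ^+ 2 :> R.
      by rewrite exprVn -exprM mulnC exprM; congr ((_ ^+ _)^-1); ring.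
    by ring.
  apply: enorm_le_entries => k; rewrite subv_entry.
  have := cell_close k (y01 _ tT) (y01 _ (ltnW (leq_trans it tT))) (esym cE).
  rewrite -(ler_pM2l W2) -{1}(gtr0_norm W2) -normrM; congr (`|_| <= _).
  by rewrite /y; field; rewrite gt_eqF.
have := sum_revisit hdim T0 A0 revisit.
set P := T%:R `^ _ => sumP.
have T0' : 0 < T%:R :> R by rewrite ltr0n.
(* Time 0 contributes at most B / T, which the rate absorbs because 2/d <= 1. *)
have invTP : T%:R^-1 <= P.
  rewrite -powR_inv1 ?ler0n // /P ler_powR ?ler1n // lerN2.
  by rewrite ler_pdivrMr ?mul1r ?ltr0n ?ler_nat ?(leq_trans _ hdim).
rewrite /average_regret big_ltn // mulrDr mulrDl lerD //.
  rewrite mulrC (le_trans (ler_wpM2r _ regret0)) ?invr_ge0 ?(ltW T0') //.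
  by rewrite ler_wpM2l // ltW.
by rewrite ler_pdivrMl // mulrCA.
Qed.
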